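(* There is a bijection between the set of all colored $P$-partitions $\mathcal{A}(P)$ and the disjoint union of the sets of colored $\pi$-partitions over all colored linear extensions $\pi$ of $P$. That is, \[ \mathcal{A}(P) \leftrightarrow \coprod_{\pi \in \mathcal{CL}(P)} \mathcal{A}(\pi). \]
   Context: Fix positive integers $r,n$. For a totally ordered set $X$, let $X_{(r)} = [0,r-1]\times X$ ordered lexicographically, write $x_k$ for $(k,x)$ and $X_k=\{k\}\times X$; put $|x_k|=x$ and $\epsilon(x_k)=k$. The colored permutation group $G_{r,n}$ consists of bijections $\pi$ of $[n]_{(r)}$ such that $\pi(i_j)=k_l$ implies $\pi(i_{j+a})=k_{l+a}$ (indices mod $r$); such $\pi$ is written in one-line notation $\pi(1)\cdots\pi(n)$ with $\pi(i)=\pi(i_0)$. An $r$-colored poset $P$ is a partially ordered (order $\prec$) finite subset of $\{0_1,\dots,0_{r-1}\}\cup[n]_{(r)}$ whose elements from $[n]_{(r)}$ have distinct absolute values, and which contains the chain $0_1\prec 0_2\prec\cdots\prec 0_{r-1}$. For $\pi\in G_{r,n}$, let the anchored $r$-colored permutations be all shuffles of the word $\pi(1)\cdots\pi(n)$ with the word $0_10_2\cdots0_{r-1}$, over all $\pi\in G_{r,n}$. The set $\mathcal{L}(P)$ of linear extensions of $P$ is the set of anchored $r$-colored permutations $w$ such that $x\prec y$ implies $x$ is to the left of $y$ in $w$. For such $w$ with underlying $\pi$, the letters $0_i$ split $\pi$ into $r$ (possibly empty) subwords numbered $0,\dots,r-1$ from left to right; let $\pi_i$ be the $i$th subword with $i$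 subtracted (mod $r$) from the color of each letter, and let $\mathcal{CL}(w)$ be the set of all shuffles of $\pi_0,\dots,\pi_{r-1}$. The colored linear extensions of $P$ are $\mathcal{CL}(P)=\coprod_{w\in\mathcal{L}(P)}\mathcal{CL}(w)$. Let $X=\{x_0<x_1<\cdots<x_\infty\}$ be a totally ordered countable set with maximal element $x_\infty$. A colored $P$-partition is a map $f:P\to X_{(r)}$ such that: (i) $f(0_k)=(k,x_0)$ for every $0_k\in P$; (ii) $f(a)\le f(b)$ if $a\prec b$; (iii) if $f(a),f(b)\in X_k$, then $f(a)<f(b)$ whenever $a\prec b$ and $|a|_{\epsilon(a)-k}>|b|_{\epsilon(b)-k}$ in $[0,n]_{(r)}$ (colors taken mod $r$); (iv) if $f(a)=(k,x_\infty)$ then $\epsilon(a)=k$. $\mathcal{A}(P)$ denotes the set of all colored $P$-partitions. For $\pi\in G_{r,n}$, $\mathcal{A}(\pi)$ denotes the set of colored $P$-partitions for the colored poset $\pi(1)\prec\pi(2)\prec\cdots\prec\pi(n)\prec0_1\prec\cdots\prec0_{r-1}$ (colored $\pi$-partitions).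
   Formalization: P is assumed to contain exactly n elements of [n]_(r), since otherwise the claim fails (r=2, n=1, P={0_1}: one colored P-partition, but infinitely many on the right), and a linear extension of P must contain every element of P as a letter. *)

(* Defs.v *)
From mathcomp Require Import all_boot all_order all_algebra all_fingroup.

Set Implicit Arguments.
Unset Strict Implicit.
Unset Printing Implicit Defensive.

Import Order.TTheory GRing.Theory.

(* Z/r for r > 0: the type 'I_r.-1.+1 always has a zero, and its additive     *)
(* structure is arithmetic modulo r when r > 0.                               *)
Notation color r := 'I_r.-1.+1.

(* X_(r): the element x_k is the pair (k, x); colors are compared first.      *)
Notation colored r X := (color r *l X)%type.

(* Letters are elements of [0,n]_(r).                                         *)
Notation letter r n := (colored r 'I_n.+1).

Definition eps (r n : nat) (a : letter r n) : color r := a.1.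

Definition abs (r n : nat) (a : letter r n) : 'I_n.+1 := a.2.

Definition zero_letter (r n : nat) (k : color r) : letter r n := (k, ord0).

(* |a|_(eps(a) - k), with the color taken modulo r. *)
Definition shift_letter (r n : nat) (k : color r) (a : letter r n) :
    letter r n :=
  ((eps a - k)%R, abs a).

(* The word 0_1 0_2 ... 0_(r-1). *)
Definition zeros (r n : nat) : seq (letter r n) :=
  [seq zero_letter n k | k <- enum (color r) & k != ord0].

(* s is obtained by interleaving the words ss i: each position of s is        *)
(* attributed to some i, and the positions attributed to i spell ss i.        *)
Definition is_shuffle (I : finType) (T : eqType) (ss : I -> seq T)
    (s : seq T) : bool :=
  [exists l : (size s).-tuple I,
    [forall i, mask [seq j == i | j <- l] s == ss i]].

(* In [n]_(r), the element i : 'I_n stands for the integer i + 1. *)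
Definition equivariant (r n : nat) (pi : {perm color r * 'I_n}) : bool :=
  [forall x : color r * 'I_n, forall c : color r,
    pi ((x.1 + c)%R, x.2) == (((pi x).1 + c)%R, (pi x).2)].

(* G_{r,n} *)
Definition colored_perm (r n : nat) : predArgType :=
  {g : {perm color r * 'I_n} | equivariant g}.

(* pi(i) = pi(i_0), with 'I_n embedded in 'I_n.+1 as {1, ..., n}. *)
Definition one_line (r n : nat) (pi : colored_perm r n) : seq (letter r n) :=
  [seq (((val pi (ord0, i)).1, lift ord0 (val pi (ord0, i)).2) : letter r n)
     | i <- enum 'I_n].

Definition anchored (r n : nat) (w : seq (letter r n)) : bool :=
  [exists pi : colored_perm r n,
    is_shuffle (fun b : bool => if b then zeros r n else one_line pi) w].

(* prec is a strict order; its values outside of the carrier are irrelevant. *)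
Record colored_poset (r n : nat) := ColoredPoset {
  carrier : {set letter r n};
  prec : rel (letter r n);
  prec_irr : {in carrier, irreflexive prec};
  prec_trans : {in carrier & &, transitive prec};
  carrier_zero0 : zero_letter n (ord0 : color r) \notin carrier;
  carrier_abs_inj : {in carrier &, forall a b,
    abs a != ord0 -> abs a = abs b -> a = b};
  carrier_zeros : forall k : color r, k != ord0 -> zero_letter n k \in carrier;
  prec_zeros : forall j k : color r, j != ord0 -> j < k ->
    prec (zero_letter n j) (zero_letter n k)
}.

(* The number of elements of P that belong to [n]_(r). *)
Definition num_nonzero (r n : nat) (P : colored_poset r n) : nat :=
  #|[set a in carrier P | abs a != ord0]|.

(* L(P); comparing positions only makes sense when the elements of P occur in *)
(* w, which has to be required also of those related to no other element.     *)
Definition lin_ext (r n : nat) (P : colored_poset r n)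
    (w : seq (letter r n)) : bool :=
  [&& anchored w,
      [forall a in carrier P, a \in w]
    & [forall a in carrier P, forall b in carrier P,
        prec P a b ==> (index a w < index b w)]].

(* pi_k: the letters of w from [n]_(r) having exactly k of the letters        *)
(* 0_1, ..., 0_(r-1) to their left, with k subtracted from their colors.      *)
Definition subword (r n : nat) (w : seq (letter r n)) (k : color r) :
    seq (letter r n) :=
  [seq shift_letter k a | a <- w &
    (abs a != ord0) &&
    (count (fun b => abs b == ord0) (take (index a w) w) == k)].

(* The relation pi \in CL(w), pi being identified with its one-line word. *)
Definition colored_shuffle (r n : nat) (w : seq (letter r n))
    (pi : colored_perm r n) : bool :=
  is_shuffle (subword w) (one_line pi).

(* CL(P) is a disjoint union: the same pi may come from several w. *)
Definition colored_lin_ext (r n : nat) (P : colored_poset r n) : Type :=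
  {wpi : seq (letter r n) * colored_perm r n |
     lin_ext P wpi.1 && colored_shuffle wpi.1 wpi.2}.

Definition is_colored_partition (r n : nat) (d : Order.disp_t)
    (X : tbOrderType d) (P : colored_poset r n)
    (f : {ffun {a : letter r n | a \in carrier P} -> colored r X}) : bool :=
  [&& [forall a, (abs (val a) == ord0) ==> (f a == (eps (val a), \bot%O))],
      [forall a, forall b, prec P (val a) (val b) ==> (f a <= f b)%O],
      [forall k : color r, forall a, forall b,
        [&& (f a).1 == k, (f b).1 == k, prec P (val a) (val b)
          & (shift_letter k (val b) < shift_letter k (val a))%O]
        ==> (f a < f b)%O]
    & [forall a, ((f a).2 == \top%O) ==> (eps (val a) == (f a).1)]].

(* A(P), with x_0 the bottom and x_infinity the top of X. *)
Definition colored_partition (r n : nat) (d : Order.disp_t)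
    (X : tbOrderType d) (P : colored_poset r n) : Type :=
  {f : {ffun {a : letter r n | a \in carrier P} -> colored r X} |
     is_colored_partition f}.

Definition chain_word (r n : nat) (pi : colored_perm r n) : seq (letter r n) :=
  one_line pi ++ zeros r n.

Definition chain_carrier (r n : nat) (pi : colored_perm r n) :
    {set letter r n} :=
  [set a in chain_word pi].

Definition chain_prec (r n : nat) (pi : colored_perm r n) : rel (letter r n) :=
  fun a b => index a (chain_word pi) < index b (chain_word pi).

Section ChainPoset.
Variables (r n : nat) (pi : colored_perm r n).

Lemma one_lineP (a : letter r n) :
  reflect (exists i : 'I_n,
    a = ((val pi (ord0, i)).1, lift ord0 (val pi (ord0, i)).2) :> letter r n)
  (a \in one_line pi).
Proof.
apply: (iffP mapP) => [[i _ ->]|[i ->]]; first by exists i.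
by exists i => //; rewrite mem_enum.
Qed.

Lemma one_line_abs (a : letter r n) : a \in one_line pi -> abs a != ord0.
Proof. by case/one_lineP=> i ->. Qed.

Lemma zerosP (a : letter r n) :
  (a \in zeros r n) = (eps a != ord0) && (abs a == ord0).
Proof.
apply/mapP/andP => [[k]|[ha /eqP ha0]].
  by rewrite mem_filter => /andP[hk _] ->.
exists (eps a); first by rewrite mem_filter ha mem_enum.
by case: a ha ha0 => k x _ /= ->.
Qed.

Lemma chain_irr : {in chain_carrier pi, irreflexive (chain_prec pi)}.
Proof. by move=> a _; rewrite /chain_prec ltnn. Qed.

Lemma chain_trans : {in chain_carrier pi & &, transitive (chain_prec pi)}.
Proof. by move=> b a c _ _ _; apply: ltn_trans. Qed.

Lemma chain_zero0 : zero_letter n (ord0 : color r) \notin chain_carrier pi.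
Proof.
rewrite inE mem_cat zerosP eqxx /= orbF; apply/negP => /one_line_abs.
by rewrite eqxx.
Qed.

Lemma one_line_abs_inj (a b : letter r n) :
  a \in one_line pi -> b \in one_line pi -> abs a = abs b -> a = b.
Proof.
move=> /one_lineP[i ->] /one_lineP[j ->] /lift_inj e.
pose c := ((val pi (ord0, j)).1 - (val pi (ord0, i)).1)%R.
have /forallP/(_ (ord0, i))/forallP/(_ c)/eqP /= := valP pi.
rewrite [((val pi (ord0, i)).1 + c)%R]addrC subrK e -surjective_pairing.
by move=> /perm_inj[_ ->].
Qed.

Lemma chain_abs_inj : {in chain_carrier pi &, forall a b,
  abs a != ord0 -> abs a = abs b -> a = b}.
Proof.
move=> a b; rewrite !inE !mem_cat !zerosP => ha hb a0 e.
move: ha hb; rewrite -e (negPf a0) !andbF !orbF => ha hb.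
exact: one_line_abs_inj.
Qed.

Lemma chain_zeros (k : color r) :
  k != ord0 -> zero_letter n k \in chain_carrier pi.
Proof. by move=> k0; rewrite inE mem_cat zerosP /= k0 eqxx orbT. Qed.

Lemma zero_letter_inj : injective (@zero_letter r n).
Proof. by move=> j k []. Qed.

Lemma chain_zero_prec (j k : color r) : j != ord0 -> j < k ->
  chain_prec pi (zero_letter n j) (zero_letter n k).
Proof.
move=> j0 jk; have k0 : k != ord0 by rewrite -lt0n (leq_ltn_trans _ jk).
have out l : zero_letter n l \notin one_line pi.
  by apply/negP=> /one_line_abs; rewrite eqxx.
rewrite /chain_prec !index_cat !(negPf (out _)) ltn_add2l.
rewrite !(index_map zero_letter_inj).
suff: sorted ltn [seq val l | l <- enum (color r) & l != ord0].
  move=> s; have u l : l != ord0 -> l \in [seq l <- enum (color r) | l != ord0].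
    by move=> l0; rewrite mem_filter l0 mem_enum.
  rewrite ltnNge; apply: contraL jk => le; rewrite -leqNgt.
  have := sorted_leq_nth leq_trans leqnn 0 (sub_sorted (@ltnW) s) _ _ _ _ le.
  by rewrite !inE !size_map !index_mem !(nth_map ord0) ?index_mem ?nth_index ?u //;
    apply.
rewrite sorted_map; apply: sorted_filter; first by move=> ???; apply: ltn_trans.
by rewrite -sorted_map val_enum_ord iota_ltn_sorted.
Qed.

End ChainPoset.

(* pi(1) < ... < pi(n) < 0_1 < ... < 0_(r-1). *)
Definition chain_poset (r n : nat) (pi : colored_perm r n) :
    colored_poset r n :=
  ColoredPoset (@chain_irr r n pi) (@chain_trans r n pi) (chain_zero0 pi)
    (@chain_abs_inj r n pi) (@chain_zeros r n pi) (@chain_zero_prec r n pi).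

(* Main.v *)
Require Import Defs.
From mathcomp Require Import all_boot all_order all_algebra all_fingroup.

Set Implicit Arguments.
Unset Strict Implicit.
Unset Printing Implicit Defensive.

Import Order.TTheory GRing.Theory.

(* Attach to a map f the key of a letter a, namely the pair of f(a) = (k, x)  *)
(* and |a|_(eps(a) - k), ordered lexicographically.  Keys are pairwise        *)
(* distinct, and f is a colored P-partition exactly when keys increase along  *)
(* P (up to the conditions on the 0_k and on x_infinity).  Hence f determines *)
(* a linear extension w, in which P is sorted by key; the letters of w        *)
(* between 0_k and 0_(k+1) are those with f-color k.  Shifting their colors   *)
(* and merging the resulting subwords by (x, shifted letter) gives pi, and    *)
(* the shifted letter of a is sent to (0, x).  Conversely (w, pi, g)          *)
(* determines f: a letter a having k of the letters 0_i to its left in w is   *)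
(* sent to (k, x), where g maps its shift to (0, x).                          *)

(** The argument follows the classical fundamental lemma of P-partitions, with one total order, the
    key order of f, doing all the work. By [colored_partitionP], conditions (ii) and (iii) together
    say that keys strictly increase along P, so f singles out one linear extension w: the letters of
    P sorted by key.

    The colors of f can be read off w. Since f(0_k) = (k, x_0), the letter 0_k has the least key of
    f-color k ([key_lt_zero]), so the letters of f-color k are exactly those with k zeros to their
    left ([zero_before]). The values in X become comparable across blocks after shifting colors, and
    sorting by them picks one shuffle pi of the blocks. On the pi side no color is left to choose:
    every letter of pi precedes 0_1, which forces color 0 ([chain_color]).

    The map from triples (w, pi, g) to P-partitions is the one constructed, and it is inverted by
    choice. [assemble_key_lt] says that w lists its letters in the key order of the assembled map;
    this yields that the map is a P-partition ([assemble_compatible]) and that it determines the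
    triple ([assemble_inj]). For [assemble_surj], the letters of P are sorted by key to get w and by
    (x, shifted letter) to get pi. *)

Lemma inj_surj_inverse_bij (T : choiceType) (S : eqType) (G : T -> S) :
  injective G -> (forall s, exists t, G t == s) ->
  exists F : S -> T, bijective F.
Proof.
move=> Ginj Gsurj; exists (fun s => xchoose (Gsurj s)); exists G.
  by move=> s; apply/eqP/(xchooseP (Gsurj s)).
by move=> t; apply/Ginj/eqP/(xchooseP (Gsurj (G t))).
Qed.

(** * Shuffles as filters, and positions in sorted words *)

Lemma mask_attribution (I T : eqType) (p : T -> I) (l : seq I) (s : seq T) :
  size l = size s ->
  (forall i x, x \in mask [seq j == i | j <- l] s -> p x = i) ->
  l = map p s.
Proof.
elim: s l => [|x s IH] [|j l] //= [sz] H.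
rewrite (H j x) ?eqxx ?mem_head //; congr cons; apply: IH => // i y ys.
by apply: H; case: ifP => // _; rewrite inE ys orbT.
Qed.

(** When [p] tells which word a letter comes from, the attribution of positions is forced to be
    [map p s], so masking becomes filtering. *)
Lemma shuffle_filter (I : finType) (T : eqType) (ss : I -> seq T) (p : T -> I)
    (s : seq T) (i : I) :
  (forall i x, x \in ss i -> p x = i) -> is_shuffle ss s ->
  [seq x <- s | p x == i] = ss i.
Proof.
move=> H /existsP[l /forallP Hl]; rewrite -(eqP (Hl i)).
have {}Hl : (l : seq I) = map p s.
  apply: mask_attribution; first by rewrite size_tuple.
  by move=> j x; rewrite (eqP (Hl j)); apply: H.
by rewrite filter_mask Hl -map_comp.
Qed.

Lemma filter_shuffle (I : finType) (T : eqType) (ss : I -> seq T) (p : T -> I)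
    (s : seq T) :
  (forall i, [seq x <- s | p x == i] = ss i) -> is_shuffle ss s.
Proof.
move=> H; apply/existsP; exists (map_tuple p (in_tuple s)).
by apply/forallP => i; rewrite /= -map_comp -(H i) filter_mask.
Qed.

Lemma index_filter_lt (T : eqType) (p : pred T) (s : seq T) (a b : T) :
  p a -> p b -> index a s < index b s ->
  index a (filter p s) < index b (filter p s).
Proof.
move=> pa pb; elim: s => //= x s IH.
have [-> //|xb] := eqVneq x b.
have [xa _|xa] := eqVneq x a.
  by rewrite xa pa /= eqxx; rewrite xa in xb; rewrite (negPf xb).
rewrite ltnS => /IH h; case: ifP => //= _.
by rewrite (negPf xa) (negPf xb) ltnS.
Qed.

Lemma sorted_index_lt (T : eqType) (lt : rel T) (s : seq T) (a b : T) :
  transitive lt -> irreflexive lt -> sorted lt s -> a \in s -> b \in s ->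
  (index a s < index b s) = lt a b.
Proof.
move=> tr irr ss sa sb; apply/idP/idP; first exact: sorted_ltn_index.
move=> ab; rewrite ltnNge leq_eqVlt; apply/negP => /orP[/eqP e|].
  by move: ab; rewrite -[a](nth_index a sa) -e nth_index // irr.
by move=> /(sorted_ltn_index tr ss) => /(_ sb sa) /(tr _ _ _ ab); rewrite irr.
Qed.

(** * Letters, one-line words and anchored words *)

Section Words.
Variables r n : nat.
Implicit Types (a b : letter r n) (w s : seq (letter r n)) (k : color r).
Implicit Types pi : colored_perm r n.

Definition iszero a := abs a == ord0.
Definition nonzero a := ~~ iszero a.

Lemma shift_letter_inj k : injective (@shift_letter r n k).
Proof.
case=> c x [d y] e; have /= /addIr -> := congr1 fst e.
by have /= -> := congr1 snd e.
Qed.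

Lemma iszeroE a : iszero a -> a = zero_letter n (eps a).
Proof. by case: a => k x /eqP /= ->. Qed.

Lemma colored_permS pi k i :
  val pi (k, i) = (((val pi (ord0, i)).1 + k)%R, (val pi (ord0, i)).2).
Proof.
have /forallP/(_ (ord0, i))/forallP/(_ k)/eqP <- := valP pi.
by rewrite /= add0r.
Qed.

Lemma one_line_inj : injective (@one_line r n).
Proof.
move=> pi rho; rewrite /one_line => /eq_in_map e; apply/val_inj/permP => -[k i].
rewrite (colored_permS pi k) (colored_permS rho k).
have {}e := e i (mem_enum _ i).
by have /= -> := congr1 fst e; have /= /lift_inj -> := congr1 snd e.
Qed.

Lemma size_one_line pi : size (one_line pi) = n.
Proof. by rewrite size_map size_enum_ord. Qed.

Lemma uniq_one_line pi : uniq (one_line pi).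
Proof.
rewrite map_inj_in_uniq ?enum_uniq // => i j _ _ e.
have /= e1 := congr1 fst e; have /= /lift_inj e2 := congr1 snd e.
have : val pi (ord0, i) = val pi (ord0, j).
  by rewrite [LHS]surjective_pairing e1 e2 -surjective_pairing.
by move/perm_inj => [].
Qed.

(** The images of the letters of color 0 determine an equivariant map, and distinct absolute values
    make it injective. *)
Lemma one_line_surj s : size s = n -> uniq (map (@abs r n) s) ->
  all nonzero s -> exists pi, one_line pi = s.
Proof.
move=> sz us s0.
have [n0|n0] := posnP n.
  have eqv : equivariant (1%g : {perm color r * 'I_n}).
    by apply/forallP => -[k [i hi]]; exfalso; rewrite n0 in hi.
  exists (exist (fun g : {perm color r * 'I_n} => equivariant g) _ eqv).
  rewrite [s]size0nil; last by rewrite sz.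
  by apply: size0nil; rewrite size_one_line.
pose c (i : 'I_n) : letter r n := nth (zero_letter n ord0) s i.
have cs i : c i \in s by rewrite mem_nth // sz.
have ltc i : (abs (c i)).-1 < n.
  rewrite prednK; first by rewrite -ltnS.
  by have /allP/(_ _ (cs i)) := s0; rewrite /nonzero /iszero -lt0n.
pose v i := Ordinal (ltc i).
have vE i : lift ord0 (v i) = abs (c i).
  apply: val_inj; rewrite /= /bump /= add1n prednK //.
  by have /allP/(_ _ (cs i)) := s0; rewrite /nonzero /iszero -lt0n.
have vinj : injective v.
  move=> i j e; apply/val_inj/eqP.
  rewrite -(nth_uniq ord0 _ _ us) ?size_map ?sz ?ltn_ord //.
  rewrite !(nth_map (zero_letter n ord0)) ?sz ?ltn_ord //.
  by rewrite -/(c i) -/(c j) -!vE e.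
(* The only equivariant extension of the word: adding a color to the argument adds it to the
   value. *)
pose h (x : color r * 'I_n) := (((c x.2).1 + x.1)%R, v x.2).
have hinj : injective h.
  move=> [k i] [l j] e; have /= /vinj ij := congr1 snd e.
  by have /= := congr1 fst e; rewrite ij => /addrI ->.
have eqv : equivariant (perm hinj).
  by apply/forallP => x; apply/forallP => k; rewrite !permE /h /= addrA.
exists (exist (fun g : {perm color r * 'I_n} => equivariant g) _ eqv).
apply: (@eq_from_nth _ (zero_letter n ord0)).
  by rewrite size_one_line sz.
move=> i; rewrite size_one_line => hi.
rewrite (nth_map (Ordinal hi)) ?size_enum_ord // permE /h /= addr0 vE.
rewrite -[i in LHS]/(val (Ordinal hi)) nth_ord_enum.
by rewrite -/(c (Ordinal hi)) -surjective_pairing.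
Qed.

Lemma uniq_zeros : uniq (zeros r n).
Proof.
rewrite map_inj_uniq; first by rewrite filter_uniq ?enum_uniq.
exact: zero_letter_inj.
Qed.

Lemma mem_zeros a : (a \in zeros r n) = iszero a && (eps a != ord0).
Proof. by rewrite zerosP andbC. Qed.

Lemma sorted_zeros : sorted (fun a b => eps a < eps b) (zeros r n).
Proof.
rewrite sorted_map; apply: sorted_filter => [???|]; first exact: ltn_trans.
by have := iota_ltn_sorted 0 r.-1.+1; rewrite -val_enum_ord sorted_map.
Qed.

(** The offset arises because the word starts with 0_1 and positions start at 0. *)
Lemma index_zeros k : k != ord0 -> index (zero_letter n k) (zeros r n) = k.-1.
Proof.
move=> k0; rewrite /zeros index_map; last exact: zero_letter_inj.
rewrite enum_ordSl /= filter_map (eq_filter (a2 := predT)) // filter_predT.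
have [k' ->] : exists k' : 'I_r.-1, k = lift ord0 k'.
  by case: (unliftP ord0 k) k0 => [k' ->|->]; [exists k'|rewrite eqxx].
by rewrite index_map ?index_enum_ord //; apply: lift_inj.
Qed.

Lemma anchoredP w : reflect
  (filter iszero w = zeros r n /\ exists pi, filter nonzero w = one_line pi)
  (anchored w).
Proof.
apply: (iffP existsP) => [[pi sh]|[ez [pi en]]].
  pose ss := fun b : bool => if b then zeros r n else one_line pi.
  have H t a : a \in ss t -> iszero a = t.
    case: t => /=; first by rewrite mem_zeros => /andP[].
    by move/one_line_abs/negPf.
  split; last exists pi.
    rewrite -[zeros r n]/(ss true) -(shuffle_filter true H sh).
    by apply: eq_filter => a; rewrite eqb_id.
  rewrite -[one_line pi]/(ss false) -(shuffle_filter false H sh).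
  by apply: eq_filter => a; rewrite eqbF_neg.
exists pi; apply: (filter_shuffle (p := iszero)) => -[] /=.
  by rewrite -ez; apply: eq_filter => a; rewrite eqb_id.
by rewrite -en; apply: eq_filter => a; rewrite eqbF_neg.
Qed.

(* In an anchored word the count is at most r - 1, so inord keeps its value. *)
Definition zeros_before w a : color r :=
  inord (count iszero (take (index a w) w)).

Section Anchored.
Variable w : seq (letter r n).
Hypothesis anc : filter iszero w = zeros r n.

Lemma size_zeros : size (zeros r n) = r.-1.
Proof.
rewrite size_map enum_ordSl /= filter_map (eq_filter (a2 := predT)) //.
by rewrite filter_predT size_map size_enum_ord.
Qed.

Lemma val_zeros_before a :
  val (zeros_before w a) = count iszero (take (index a w) w).
Proof.
rewrite /= inordK // ltnS; apply: leq_trans (_ : size (zeros r n) <= _).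
  rewrite -anc size_filter.
  by rewrite -[in X in _ <= X](cat_take_drop (index a w) w) count_cat leq_addr.
by rewrite size_zeros.
Qed.

Lemma zeros_before_mono a b :
  index a w <= index b w -> (zeros_before w a <= zeros_before w b)%N.
Proof.
move=> ab; rewrite !val_zeros_before.
rewrite -[take (index b w) w](cat_take_drop (index a w)).
by rewrite count_cat take_takel // leq_addr.
Qed.

Lemma zero_mem k : k != ord0 -> zero_letter n k \in w.
Proof.
move=> k0; have : zero_letter n k \in zeros r n.
  by rewrite mem_zeros /iszero eqxx.
by rewrite -anc mem_filter => /andP[].
Qed.

(** The zeros occur in [w] in the order 0_1, 0_2, ..., so those to the left of [a] form an initial
    segment of [zeros r n], and its length decides which ones they are. *)
Lemma zero_before k a : k != ord0 ->
  (index (zero_letter n k) w < index a w) = (k <= zeros_before w a).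
Proof.
move=> k0; rewrite -(in_take _ (zero_mem k0)).
have zk : iszero (zero_letter n k) by rewrite /iszero eqxx.
have -> : (zero_letter n k \in take (index a w) w) =
    (zero_letter n k \in filter iszero (take (index a w) w)).
  by rewrite mem_filter zk.
have -> : filter iszero (take (index a w) w) =
    take (zeros_before w a) (zeros r n).
  rewrite val_zeros_before -anc -{5}(cat_take_drop (index a w) w).
  by rewrite filter_cat take_size_cat // size_filter.
rewrite in_take ?mem_zeros ?zk ?k0 // index_zeros //.
by rewrite prednK // lt0n.
Qed.

Lemma zero_zero_before j k : j != ord0 -> k != ord0 ->
  index (zero_letter n j) w < index (zero_letter n k) w -> j < k.
Proof.
move=> j0 k0 /(@index_filter_lt _ iszero); rewrite /iszero eqxx => /(_ isT isT).
rewrite -/iszero anc !index_zeros // -ltnS.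
by rewrite (@prednK j) ?lt0n // (@prednK k) ?lt0n.
Qed.

End Anchored.
End Words.

Lemma lt_lexiE (d1 d2 : Order.disp_t) (T1 : orderType d1) (T2 : orderType d2)
    (x y : T1 *l T2) :
  (x < y)%O = (x.1 < y.1)%O || (x.1 == y.1) && (x.2 < y.2)%O.
Proof. by rewrite ltEprodlexi; case: (ltgtP x.1 y.1). Qed.

(** * The key order and its relation to colored P-partitions *)

Section Key.
Variables (r n : nat) (d : Order.disp_t) (X : tbOrderType d).
Implicit Types (f g h : letter r n -> colored r X) (a b : letter r n).
Implicit Types (P : colored_poset r n) (k : color r).

Definition key f a : (colored r X *l letter r n)%type :=
  (f a, shift_letter (f a).1 a).

Definition key_lt f : rel (letter r n) := fun a b => (key f a < key f b)%O.

Lemma key_inj f : injective (key f).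
Proof.
move=> a b e; have /= e1 := congr1 fst e; have := congr1 snd e.
by rewrite /= e1 => /shift_letter_inj.
Qed.

Lemma key_lt_trans f : transitive (key_lt f).
Proof. by move=> b a c; apply: lt_trans. Qed.

Lemma key_lt_irr f : irreflexive (key_lt f).
Proof. by move=> a; rewrite /key_lt ltxx. Qed.

Lemma key_ltE f a b : key_lt f a b = (f a < f b)%O ||
  (f a == f b) && (shift_letter (f a).1 a < shift_letter (f a).1 b)%O.
Proof.
rewrite /key_lt lt_lexiE /=; case: (f a =P f b) => [->|_] //.
Qed.

Lemma key_lt_color f a b : ((f a).1 < (f b).1)%N -> key_lt f a b.
Proof. by rewrite key_ltE lt_lexiE ltEord => ->. Qed.

Lemma key_lt_same f a b k : (f a).1 = k -> (f b).1 = k ->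
  key_lt f a b = ((f a).2 < (f b).2)%O ||
   ((f a).2 == (f b).2) && (shift_letter k a < shift_letter k b)%O.
Proof.
rewrite key_ltE lt_lexiE; case: (f a) (f b) => [ka x] [kb y] /= -> ->.
by rewrite ltxx eqxx xpair_eqE eqxx.
Qed.

Lemma key_lt_total f a b : a != b -> key_lt f a b = ~~ key_lt f b a.
Proof.
move=> ab; rewrite /key_lt -leNgt lt_neqAle; case: eqP => // /key_inj e.
by rewrite e eqxx in ab.
Qed.

(** Among keys of color k, that of 0_k is least: its value in X is the bottom, and its shift is the
    least letter, of color 0 and absolute value 0. *)
Lemma key_lt_zero f a k : nonzero a -> f (zero_letter n k) = (k, \bot%O) ->
  key_lt f (zero_letter n k) a = (k <= (f a).1).
Proof.
move=> a0 fk; have := @key_lt_color f (zero_letter n k) a.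
have := @key_lt_color f a (zero_letter n k).
have ne : zero_letter n k != a.
  by apply: contraNneq a0 => <-; rewrite /iszero eqxx.
rewrite fk /= (key_lt_total f ne); case: (ltngtP k (f a).1).
- by move=> _ _ ->.
- by move=> _ ->.
move=> /val_inj e _ _; rewrite (key_lt_same (k := k)) ?fk //= ltx0 lt_lexiE /=.
by rewrite subrr !ltEord /= !ltn0 !andbF.
Qed.

(* The key of f turns conditions (ii) and (iii) into one monotonicity. *)
Definition compatible P f : Prop :=
  [/\ {in carrier P, forall a, iszero a -> f a = (eps a, \bot%O)},
      {in carrier P &, forall a b, prec P a b -> key_lt f a b}
    & {in carrier P, forall a, (f a).2 = \top%O -> eps a = (f a).1}].

(** If f(a) < f(b) the keys already increase. If f(a) = f(b), condition (iii) at the common color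
    forbids a descent of the shifted letters, and equal shifts would give a = b, against
    irreflexivity of the order. *)
Lemma colored_partitionP P
    (f : {ffun {a : letter r n | a \in carrier P} -> colored r X}) h :
  (forall u, f u = h (val u)) ->
  is_colored_partition f <-> compatible P h.
Proof.
move=> fh; split.
  move=> /and4P[/forallP h1 /forallP h2 /forallP h3 /forallP h4].
  split=> [a aP a0|a b aP bP ab|a aP /eqP atop].
  - by have := h1 (exist _ a aP); rewrite fh /= -/(iszero a) a0 => /eqP.
  - have /forallP/(_ (exist _ b bP)) := h2 (exist _ a aP).
    have /forallP/(_ (exist _ a aP))/forallP/(_ (exist _ b bP)) := h3 (h a).1.
    rewrite !fh /= ab eqxx /= key_ltE le_eqVlt.
    have [<- /= c3 _|_ _ /orP[//|->//]] := eqVneq (h a) (h b).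
    move: c3; rewrite eqxx ltxx implybF -leNgt le_eqVlt => /orP[/eqP|//].
    by move=> /shift_letter_inj eab; move: ab; rewrite eab prec_irr.
  - by have := h4 (exist _ a aP); rewrite fh /= atop => /eqP.
move=> [h1 h2 h3]; apply/and4P; split.
- by apply/forallP => -[a aP]; apply/implyP; rewrite fh /= => /(h1 _ aP) ->.
- apply/forallP => -[a aP]; apply/forallP => -[b bP]; rewrite !fh /=.
  apply/implyP => /(h2 _ _ aP bP); rewrite key_ltE => /orP[/ltW //|].
  by case/andP => /eqP ->.
- apply/forallP => k; apply/forallP => -[a aP]; apply/forallP => -[b bP].
  rewrite !fh /=; apply/implyP => /and4P[/eqP ka _ /(h2 _ _ aP bP)].
  rewrite key_ltE ka => /orP[//|/andP[_]]; case: ltgtP => //.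
- apply/forallP => -[a aP]; rewrite fh /=; apply/implyP => /eqP /(h3 _ aP) ->.
  by rewrite eqxx.
Qed.

(** Passing to total maps lets [key] and [compatible] treat P and the chain posets alike. *)
Definition extend P (f : {ffun {a : letter r n | a \in carrier P} ->
    colored r X}) a : colored r X :=
  if insub a is Some u then f u else (eps a, \bot%O).

Lemma extendE P (f : {ffun {a : letter r n | a \in carrier P} ->
    colored r X}) u : f u = extend f (val u).
Proof. by rewrite /extend valK. Qed.

End Key.

Lemma index_sorted (T : eqType) (lt : rel T) (s : seq T) : uniq s ->
  {in s &, forall a b, index a s < index b s -> lt a b} -> sorted lt s.
Proof.
case: s => // x s us H; apply/(sortedP x) => i hi.
by apply: H; rewrite ?mem_nth ?index_uniq // ltnW.
Qed.

(** * From a triple (w, pi, g) to a map on the letters *)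

Section Forward.
Variables (r n : nat) (d : Order.disp_t) (X : tbOrderType d).
Implicit Types (f g h : letter r n -> colored r X) (a b : letter r n).
Implicit Types (P : colored_poset r n) (k : color r).
Implicit Types (w : seq (letter r n)) (pi : colored_perm r n).

Lemma subwordE w k : filter (@iszero r n) w = zeros r n ->
  subword w k = [seq shift_letter k a |
    a <- w & nonzero a && (zeros_before w a == k)].
Proof.
move=> anc; congr map; apply: eq_filter => a.
by rewrite -(val_zeros_before anc).
Qed.

Lemma mem_subword w k b : filter (@iszero r n) w = zeros r n ->
  reflect (exists a, [/\ a \in w, nonzero a, zeros_before w a = k
                       & b = shift_letter k a])
    (b \in subword w k).
Proof.
move=> anc; rewrite subwordE //; apply: (iffP mapP) => [[a]|[a [aw a0 ak ->]]].
  by rewrite mem_filter => /andP[/andP[a0 /eqP ak] aw] ->; exists a.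
by exists a => //; rewrite mem_filter a0 aw ak eqxx.
Qed.

Section Shuffle.
Variables (w : seq (letter r n)) (pi : colored_perm r n).
Hypothesis anc : filter (@iszero r n) w = zeros r n.
Hypothesis w_abs : {in w &, forall a b, nonzero a -> abs a = abs b -> a = b}.
Hypothesis sh : colored_shuffle w pi.

(** Shifting keeps absolute values, and these identify the letters of [w]; hence the subwords have
    disjoint letters and a letter of [pi] reveals its block. *)
Lemma colored_shuffle_filter : exists p : letter r n -> color r,
  forall k, [seq b <- one_line pi | p b == k] = subword w k.
Proof.
exists (fun b => odflt ord0 [pick k | b \in subword w k]) => k.
apply: (shuffle_filter (ss := subword w)) sh => {}k b bk.
case: pickP => [l bl|/(_ k)]; last by rewrite bk.
have /(mem_subword _ _ anc) [a1 [a1w a10 <- e1]] := bk.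
have /(mem_subword _ _ anc) [a2 [a2w a20 <- e2]] /= := bl.
rewrite (w_abs a1w a2w a10) //.
by have /= := congr1 (@abs r n) e1; rewrite e2.
Qed.

Lemma mem_one_line b :
  reflect (exists a, [/\ a \in w, nonzero a
                       & b = shift_letter (zeros_before w a) a])
    (b \in one_line pi).
Proof.
apply: (iffP idP) => [bpi|[a [aw a0 eb]]].
  have [p Hp] := colored_shuffle_filter.
  have /(mem_subword _ _ anc) [a [aw a0 <- eb]] : b \in subword w (p b).
    by rewrite -Hp mem_filter eqxx.
  by exists a.
have [p Hp] := colored_shuffle_filter.
have : b \in subword w (zeros_before w a) by apply/mem_subword => //; exists a.
by rewrite -Hp mem_filter => /andP[].
Qed.

End Shuffle.

Section Chain.
Variables (pi : colored_perm r n) (g : letter r n -> colored r X).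
Hypothesis gP : compatible (chain_poset pi) g.

(** For r > 1, [b] precedes 0_1, whose key is the least of color 1, so the color of [g b] is below
    1; otherwise there is only one color. *)
Lemma chain_color b : b \in one_line pi -> (g b).1 = ord0.
Proof.
move=> bpi; have [r1|r1] := posnP r.-1.
  apply/val_inj/eqP; rewrite /= -leqn0 -ltnS.
  by apply: leq_trans (ltn_ord _) _; rewrite r1.
have [g0 gprec _] := gP; pose k : color r := inord 1.
have k1 : k = 1 :> nat by rewrite inordK.
have k0 : k != ord0 by apply/eqP => /(congr1 val); rewrite /= k1.
have kc : zero_letter n k \in chain_carrier pi by apply: chain_zeros.
have bc : b \in chain_carrier pi by rewrite inE mem_cat bpi.
have gk : g (zero_letter n k) = (k, \bot%O) by rewrite g0 ?/iszero ?eqxx.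
have kpi : zero_letter n k \notin one_line pi.
  by apply/negP => /one_line_abs; rewrite eqxx.
have := gprec _ _ bc kc; rewrite /= /chain_prec !index_cat bpi (negPf kpi).
rewrite ltn_addr ?index_mem // => /(_ isT).
have bk : b != zero_letter n k by apply: contraNneq kpi => <-.
rewrite (key_lt_total _ bk) (key_lt_zero (one_line_abs bpi) gk) k1 -eqn0Ngt.
by move=> /eqP e; apply: val_inj.
Qed.

Lemma chain_sorted : sorted (key_lt g) (one_line pi).
Proof.
have [_ gprec _] := gP.
apply: index_sorted (uniq_one_line pi) _ => a b api bpi ab.
apply: gprec; rewrite ?inE ?mem_cat ?api ?bpi //=.
by rewrite /chain_prec !index_cat api bpi.
Qed.

End Chain.

Definition assemble w g a : colored r X :=
  if iszero a then (eps a, \bot%O) else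
  (zeros_before w a, (g (shift_letter (zeros_before w a) a)).2).

Section Assemble.
Variables (w : seq (letter r n)) (pi : colored_perm r n).
Variable g : letter r n -> colored r X.
Hypothesis anc : filter (@iszero r n) w = zeros r n.
Hypothesis w_abs : {in w &, forall a b, nonzero a -> abs a = abs b -> a = b}.
Hypothesis sh : colored_shuffle w pi.
Hypothesis gP : compatible (chain_poset pi) g.

Lemma assemble_zero a : iszero a -> assemble w g a = (eps a, \bot%O).
Proof. by rewrite /assemble => ->. Qed.

Lemma assemble_nonzero a : nonzero a -> assemble w g a =
  (zeros_before w a, (g (shift_letter (zeros_before w a) a)).2).
Proof. by rewrite /assemble => /negPf ->. Qed.

Lemma chain_value a : a \in w -> nonzero a ->
  g (shift_letter (zeros_before w a) a) = (ord0, (assemble w g a).2).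
Proof.
move=> aw a0; rewrite assemble_nonzero //= [LHS]surjective_pairing.
congr pair; apply: (chain_color gP).
by apply/(mem_one_line anc w_abs sh); exists a.
Qed.

(** The block number is the color, and it weakly increases along [w]; a zero opens its block with
    the least key. Within a block the order comes from [pi], along which the keys of [g]
    increase. *)
Lemma assemble_key_lt :
  {in w &, forall a b, index a w < index b w -> key_lt (assemble w g) a b}.
Proof.
have zeps a : a \in w -> iszero a -> eps a != ord0.
  move=> aw a0; have : a \in zeros r n by rewrite -anc mem_filter a0.
  by rewrite mem_zeros a0.
move=> a b aw bw ab.
have [b0|b0] := boolP (iszero b).
  apply: key_lt_color; rewrite (assemble_zero b0) /=.
  have kb := zeps b bw b0; move: ab; rewrite (iszeroE b0).
  have [a0|a0] := boolP (iszero a).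
    have ka := zeps a aw a0; rewrite assemble_zero // {1}(iszeroE a0).
    exact: zero_zero_before.
  rewrite assemble_nonzero //= => ab.
  by rewrite ltnNge -zero_before // -leqNgt ltnW.
have [a0|a0] := boolP (iszero a).
  have fa : assemble w g (zero_letter n (eps a)) = (eps a, \bot%O).
    by rewrite assemble_zero /iszero ?eqxx.
  rewrite {1}(iszeroE a0) (key_lt_zero b0 fa) assemble_nonzero //=.
  by rewrite -(zero_before anc) ?zeps // -iszeroE.
have := zeros_before_mono anc (ltnW ab).
rewrite leq_eqVlt => /orP[/eqP/val_inj e|lt]; last first.
  by apply: key_lt_color; rewrite !assemble_nonzero.
have [p Hp] := colored_shuffle_filter anc w_abs sh.
pose k := zeros_before w a.
(* Both letters lie in block [k]; its subword is a filter of [one_line pi] and inherits the key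
   order of [g]. *)
have : sorted (key_lt g) (subword w k).
  rewrite -Hp.
  exact: sorted_filter (@key_lt_trans _ _ _ _ g) _ _ (chain_sorted gP).
rewrite subwordE // sorted_map => st.
have := sorted_ltn_index (fun _ _ _ => @key_lt_trans _ _ _ _ g _ _ _) st.
move=> /(_ a b); rewrite !mem_filter /nonzero aw bw a0 b0 -e eqxx.
move=> /(_ isT isT).
rewrite index_filter_lt ?a0 ?b0 -?e ?eqxx // => /(_ isT) /=.
have ga := chain_value aw a0; have gb := chain_value bw b0.
rewrite -e in gb; rewrite /k.
(* Since [g] has color 0 here, its key shifts by 0 and compares the same data as the assembled key:
   the value in X, then the letter shifted by [k]. *)
rewrite (key_lt_same (k := ord0)) ?ga ?gb //.
rewrite (key_lt_same (k := k)) ?assemble_nonzero //=.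
rewrite /shift_letter /= !subr0 //.
Qed.

End Assemble.
End Forward.

(** * The assembled map is a P-partition and determines its triple *)

Section Bijection.
Variables (r n : nat) (d : Order.disp_t) (X : tbOrderType d).
Variable P : colored_poset r n.
Hypothesis hP : num_nonzero P = n.
Implicit Types (f g h : letter r n -> colored r X) (a b : letter r n).
Implicit Types (k : color r).
Implicit Types (w : seq (letter r n)) (pi : colored_perm r n).

Lemma carrier_inj : {in carrier P &, forall a b,
  nonzero a -> abs a = abs b -> a = b}.
Proof. exact: carrier_abs_inj. Qed.

Lemma carrier_iszero a : iszero a -> (a \in carrier P) = (eps a != ord0).
Proof.
move=> /iszeroE ->; rewrite /=.
case: eqVneq => [->|]; last exact: carrier_zeros.
exact/negbTE/carrier_zero0.
Qed.

(** A count: [w] has n nonzero letters and contains those of P, of which there are also n by [hP],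
    so no letter of [w] lies outside P. *)
Lemma lin_ext_word w : lin_ext P w ->
  [/\ w =i carrier P, uniq w & filter (@iszero r n) w = zeros r n].
Proof.
move=> /and3P[/anchoredP[ez [pi en]] /forallP cwP _].
have uw : uniq w.
  rewrite -(perm_uniq (permEl (perm_filterC (@iszero r n) w))) cat_uniq.
  rewrite -[filter (predC _) w]/(filter (@nonzero r n) w) ez uniq_zeros en.
  rewrite uniq_one_line andbT; apply/hasPn => a /one_line_abs a0.
  by rewrite mem_zeros negb_and a0.
have cw a : a \in carrier P -> a \in w by move=> aP; have := cwP a; rewrite aP.
split=> // a; apply/idP/idP => [aw|]; last exact: cw.
have [a0|a0] := boolP (iszero a).
  have : a \in zeros r n by rewrite -ez mem_filter a0.
  by rewrite mem_zeros carrier_iszero // => /andP[].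
pose N := enum [set b in carrier P | abs b != ord0].
have sub : {subset N <= filter (@nonzero r n) w}.
  move=> b; rewrite mem_enum inE mem_filter => /andP[bP b0].
  by rewrite cw // andbT.
have [|_ NE] := uniq_min_size (enum_uniq _) sub.
  by rewrite en size_one_line -cardE -[X in X <= _]hP.
have : a \in N by rewrite NE mem_filter /nonzero a0.
by rewrite mem_enum inE => /andP[].
Qed.

Lemma assemble_compatible w pi g : lin_ext P w -> colored_shuffle w pi ->
  compatible (chain_poset pi) g -> compatible P (assemble w g).
Proof.
move=> wP sh gP; have [wE uw anc] := lin_ext_word wP.
have w_abs : {in w &, forall a b, nonzero a -> abs a = abs b -> a = b}.
  by move=> a b; rewrite !wE; apply: carrier_inj.
split=> [a aP|a b aP bP ab|a aP].
- exact: assemble_zero.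
- apply: (assemble_key_lt anc w_abs sh gP); rewrite ?wE //.
  have /and3P[_ _ /forallP/(_ a)] := wP.
  by rewrite aP => /forallP/(_ b); rewrite bP ab.
have [a0|a0] := boolP (iszero a); first by rewrite assemble_zero.
move=> atop; have aw : a \in w by rewrite wE.
have := chain_value anc w_abs sh gP aw a0; rewrite atop => ga.
have [_ _ gtop] := gP.
have bpi : shift_letter (zeros_before w a) a \in chain_carrier pi.
  rewrite inE mem_cat; apply/orP; left.
  by apply/(mem_one_line anc w_abs sh); exists a.
(* Condition (iv) for [g], whose color here is 0, says that the shifted letter has color 0, so the
   color of [a] equals its block number. *)
have := gtop _ bpi; rewrite ga => /(_ erefl) /= /eqP.
by rewrite subr_eq0 assemble_nonzero // => /eqP.
Qed.

(** The word [w] is the carrier sorted by the assembled key. It fixes the blocks, hence the letters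
    of [pi] and the values of [g] on them; then [pi] is these letters sorted by the key of [g]. *)
Lemma assemble_inj w pi g w' pi' g' :
  lin_ext P w -> colored_shuffle w pi -> compatible (chain_poset pi) g ->
  lin_ext P w' -> colored_shuffle w' pi' -> compatible (chain_poset pi') g' ->
  {in carrier P, assemble w g =1 assemble w' g'} ->
  [/\ w = w', pi = pi' & {in chain_carrier pi, g =1 g'}].
Proof.
move=> wP sh gP wP' sh' gP' E.
have [wE uw anc] := lin_ext_word wP; have [wE' uw' anc'] := lin_ext_word wP'.
have w_abs : {in w &, forall a b, nonzero a -> abs a = abs b -> a = b}.
  by move=> a b; rewrite !wE; apply: carrier_inj.
have w_abs' : {in w' &, forall a b, nonzero a -> abs a = abs b -> a = b}.
  by move=> a b; rewrite !wE'; apply: carrier_inj.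
have eqw : w = w'.
  apply: (irr_sorted_eq (@key_lt_trans _ _ _ _ (assemble w g))).
  - exact: key_lt_irr.
  - by apply: index_sorted uw _; apply: assemble_key_lt anc w_abs sh gP.
  - apply: index_sorted uw' _ => a b aw bw ab.
    have := assemble_key_lt anc' w_abs' sh' gP' aw bw ab.
    by rewrite /key_lt /key !E // -wE'.
  - by move=> a; rewrite wE wE'.
move: sh' E; rewrite -eqw => sh' E.
have eqg : {in one_line pi, g =1 g'}.
  move=> b /(mem_one_line anc w_abs sh)[a [aw a0 ->]].
  rewrite (chain_value anc w_abs sh gP) // (chain_value anc w_abs sh' gP') //.
  by rewrite E // -wE.
have mem_eq : one_line pi =i one_line pi'.
  move=> b; apply/(mem_one_line anc w_abs sh)/(mem_one_line anc w_abs sh');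
  exact.
have eqpi : pi = pi'.
  apply: one_line_inj.
  apply: (irr_sorted_eq (@key_lt_trans _ _ _ _ g)) (mem_eq).
  - exact: key_lt_irr.
  - exact: chain_sorted gP.
  apply: sub_in_sorted (allss _) (chain_sorted gP') => a b.
  by rewrite -!mem_eq /key_lt /key => api bpi; rewrite !eqg.
split=> // b; rewrite inE mem_cat => bc.
have [b0|b0] := boolP (iszero b).
  have [gz _ _] := gP; have [gz' _ _] := gP'.
  by rewrite gz ?gz' // inE /chain_word ?mem_cat -?eqpi.
apply: eqg; case/orP: bc => //; by rewrite mem_zeros (negPf b0).
Qed.

End Bijection.

Lemma sort_key_lt (T : eqType) (d : Order.disp_t) (U : orderType d)
    (key : T -> U) (s : seq T) : {in s &, injective key} -> uniq s ->
  sorted (relpre key <%O) (sort (relpre key <=%O) s).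
Proof.
move=> inj us; rewrite -sorted_map lt_sorted_uniq_le map_inj_in_uniq.
  rewrite sort_uniq us sorted_map sort_sorted // => a b; exact: le_total.
by move=> a b; rewrite !mem_sort; apply: inj.
Qed.

(** * Every P-partition is assembled from some triple *)

Section Surjection.
Variables (r n : nat) (d : Order.disp_t) (X : tbOrderType d).
Variable P : colored_poset r n.
Hypothesis hP : num_nonzero P = n.
Variable f : letter r n -> colored r X.
Hypothesis fP : compatible P f.
Implicit Types (a b : letter r n) (k : color r).

Lemma sorted_zeros_key (g : letter r n -> colored r X) :
  {in zeros r n, forall a, g a = (eps a, \bot%O)} ->
  sorted (key_lt g) (zeros r n).
Proof.
move=> gz; apply: sub_in_sorted (allss _) (@sorted_zeros r n) => a b az bz ab.
by apply: key_lt_color; rewrite !gz.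
Qed.

Definition extension_word : seq (letter r n) :=
  sort (relpre (key f) <=%O) (enum (carrier P)).

Lemma mem_extension_word : extension_word =i carrier P.
Proof. by move=> a; rewrite mem_sort mem_enum. Qed.

Lemma extension_word_sorted : sorted (key_lt f) extension_word.
Proof. by apply: sort_key_lt (enum_uniq _) => a b _ _; apply: key_inj. Qed.

Lemma extension_word_zeros : filter (@iszero r n) extension_word = zeros r n.
Proof.
have [fz _ _] := fP.
apply: (irr_sorted_eq (@key_lt_trans _ _ _ _ f)); first exact: key_lt_irr.
- by apply: sorted_filter extension_word_sorted; apply: key_lt_trans.
- apply: sorted_zeros_key => a; rewrite mem_zeros => /andP[a0 ea].
  by rewrite fz ?carrier_iszero.
move=> a; rewrite mem_filter mem_zeros mem_extension_word.
by case a0: (iszero a); rewrite //= carrier_iszero.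
Qed.

Lemma size_nonzero_carrier :
  size [seq a <- enum (carrier P) | nonzero a] = n.
Proof.
rewrite -[RHS]hP /num_nonzero cardE; apply: perm_size.
apply: uniq_perm => [||a]; [exact/filter_uniq/enum_uniq|exact: enum_uniq|].
by rewrite mem_filter !mem_enum inE andbC.
Qed.

Lemma nonzero_one_line (s : seq (letter r n)) (F : letter r n -> letter r n) :
  perm_eq s [seq a <- enum (carrier P) | nonzero a] ->
  (forall a, abs (F a) = abs a) -> exists pi, one_line pi = map F s.
Proof.
move=> perm_s absF.
have sE a : (a \in s) = (nonzero a && (a \in carrier P)).
  by rewrite (perm_mem perm_s) mem_filter mem_enum.
apply: one_line_surj.
- by rewrite size_map (perm_size perm_s) size_nonzero_carrier.
- rewrite -map_comp map_inj_in_uniq.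
    by rewrite (perm_uniq perm_s) filter_uniq ?enum_uniq.
  move=> a b; rewrite !sE /= !absF => /andP[a0 aP] /andP[_ bP].
  exact: (carrier_inj aP bP).
- apply/allP => _ /mapP[a + ->]; rewrite sE /nonzero /iszero absF.
  by case/andP.
Qed.

Lemma extension_word_lin_ext : lin_ext P extension_word.
Proof.
have [_ fprec _] := fP; apply/and3P; split.
- apply/anchoredP; split; first exact: extension_word_zeros.
  have [|//|pi] := @nonzero_one_line (filter (@nonzero r n) extension_word) id.
    by apply: perm_filter; rewrite perm_sort.
  by rewrite map_id => <-; exists pi.
- by apply/forallP => a; apply/implyP; rewrite mem_extension_word.
apply/forallP => a; apply/implyP => aP; apply/forallP => b; apply/implyP => bP.
apply/implyP => ab; rewrite (sorted_index_lt _ _ extension_word_sorted).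
- exact: fprec.
- exact: key_lt_trans.
- exact: key_lt_irr.
- by rewrite mem_extension_word.
- by rewrite mem_extension_word.
Qed.

(** Both sides dominate the same nonzero colors k: each inequality says that 0_k comes before [a],
    once by position and once by key. *)
Lemma zeros_before_extension a : a \in carrier P -> nonzero a ->
  zeros_before extension_word a = (f a).1.
Proof.
move=> aP a0; have [fz _ _] := fP; apply: val_inj.
have H k : k != ord0 -> (k <= zeros_before extension_word a) = (k <= (f a).1).
  move=> k0; have kP := carrier_zeros P k0.
  rewrite -(zero_before extension_word_zeros) //.
  rewrite (sorted_index_lt _ _ extension_word_sorted) ?mem_extension_word //.
  - by rewrite key_lt_zero // fz // /iszero eqxx.
  - exact: key_lt_trans.
  - exact: key_lt_irr.
apply/eqP; rewrite eqn_leq; apply/andP; split.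
  have [->//|z0] := eqVneq (zeros_before extension_word a) ord0.
  by rewrite -H.
have [->//|z0] := eqVneq (f a).1 ord0.
by rewrite H.
Qed.

(** This is [key] with the color of f dropped: blocks become comparable with each other, and inside
    one block the order is that of [key]. *)
Definition shuffle_key a : X *l letter r n :=
  ((f a).2, shift_letter (f a).1 a).

Definition shuffle_word : seq (letter r n) :=
  sort (relpre shuffle_key <=%O) [seq a <- enum (carrier P) | nonzero a].

Lemma mem_shuffle_word a :
  (a \in shuffle_word) = nonzero a && (a \in carrier P).
Proof. by rewrite mem_sort mem_filter mem_enum. Qed.

Lemma shuffle_word_sorted : sorted (relpre shuffle_key <%O) shuffle_word.
Proof.
apply: sort_key_lt; last by rewrite filter_uniq ?enum_uniq.
move=> a b; rewrite -(mem_sort (relpre shuffle_key <=%O)) mem_shuffle_word.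
rewrite -(mem_sort (relpre shuffle_key <=%O)) mem_shuffle_word.
move=> /andP[a0 aP] /andP[_ bP] e.
by apply: (carrier_inj aP bP a0); have /= := congr1 (@abs r n \o snd) e.
Qed.

(** Undoes any color shift, since an absolute value identifies a nonzero letter of P. *)
Definition letter_of b : letter r n :=
  odflt b [pick a in carrier P | abs a == abs b].

Lemma letter_of_shift a k : a \in carrier P -> nonzero a ->
  letter_of (shift_letter k a) = a.
Proof.
move=> aP a0; rewrite /letter_of; case: pickP => [b /andP[bP /eqP e]|].
  by apply/esym/(carrier_inj aP bP a0).
by move=> /(_ a); rewrite aP eqxx.
Qed.

Definition chain_partition b : colored r X :=
  if iszero b then (eps b, \bot%O) else (ord0, (f (letter_of b)).2).

Lemma chain_partition_shift a k : a \in carrier P -> nonzero a ->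
  chain_partition (shift_letter k a) = (ord0, (f a).2).
Proof.
move=> aP a0; rewrite /chain_partition letter_of_shift //.
by rewrite /iszero -[abs _ == _]/(iszero a) (negPf a0).
Qed.

Section OneLine.
Variable pi : colored_perm r n.
Hypothesis piE :
  one_line pi = [seq shift_letter (f a).1 a | a <- shuffle_word].

Lemma chain_partition_compatible : compatible (chain_poset pi) chain_partition.
Proof.
have [_ _ ftop] := fP.
have gz b : iszero b -> chain_partition b = (eps b, \bot%O).
  by rewrite /chain_partition => ->.
have gpi b : b \in one_line pi -> exists a,
    [/\ a \in carrier P, nonzero a & b = shift_letter (f a).1 a].
  rewrite piE => /mapP[a]; rewrite mem_shuffle_word => /andP[a0 aP] ->.
  by exists a.
split=> [b _ b0|a b|b].
- exact: gz.
- rewrite !inE => ac bc; apply: sorted_ltn_index ac bc => //.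
    exact: key_lt_trans.
  (* Three comparisons remain: letters of [pi] (color 0) against zeros (color at least 1), letters
     of [pi] among themselves, and zeros among themselves. *)
  rewrite (sorted_pairwise (@key_lt_trans _ _ _ _ _)) pairwise_cat.
  rewrite -!(sorted_pairwise (@key_lt_trans _ _ _ _ _)).
  apply/and3P; split.
  + apply/allrelP => x z /gpi[y [yP y0 ->]]; rewrite mem_zeros => /andP[z0 ez].
    by apply: key_lt_color; rewrite chain_partition_shift // gz // lt0n.
  + rewrite piE sorted_map.
    apply: sub_in_sorted (allss _) shuffle_word_sorted => x y.
    rewrite !mem_shuffle_word => /andP[x0 xP] /andP[y0 yP] /=.
    rewrite (key_lt_same (k := ord0)) ?chain_partition_shift //=.
    by rewrite lt_lexiE /= /shift_letter /= !subr0.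
  + by apply: sorted_zeros_key => z; rewrite mem_zeros => /andP[/gz].
(* At the top value, condition (iv) for f gives [a] the color of [f a], so its shift has color 0, as
   required. *)
- rewrite inE mem_cat => /orP[/gpi[a [aP a0 ->]]|].
    rewrite chain_partition_shift //= => /(ftop _ aP) ->.
    by rewrite subrr.
  by rewrite mem_zeros => /andP[/gz -> _].
Qed.

(** On letters of f-color k the orders by [shuffle_key] and by [key] agree, so block k comes out the
    same whether filtered from [shuffle_word] or from [extension_word]. *)
Lemma chain_partition_shuffle : colored_shuffle extension_word pi.
Proof.
apply: (filter_shuffle (p := fun b => (f (letter_of b)).1)) => k.
rewrite (subwordE _ extension_word_zeros) piE filter_map.
have /eq_in_filter -> : {in shuffle_word, forall a,
    (f (letter_of (shift_letter (f a).1 a))).1 == k = ((f a).1 == k)}.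
  move=> a; rewrite mem_shuffle_word => /andP[a0 aP].
  by rewrite letter_of_shift.
have /eq_in_map -> : {in [seq a <- shuffle_word | (f a).1 == k], forall a,
    shift_letter (f a).1 a = shift_letter k a}.
  by move=> a; rewrite mem_filter => /andP[/eqP ->].
congr map; apply: (irr_sorted_eq (@key_lt_trans _ _ _ _ f)).
- exact: key_lt_irr.
- have : sorted (relpre shuffle_key <%O) [seq a <- shuffle_word | (f a).1 == k].
    by apply: sorted_filter shuffle_word_sorted => x y z; apply: lt_trans.
  apply: sub_in_sorted (allss _) => x y; rewrite !mem_filter.
  move=> /andP[/eqP xk _] /andP[/eqP yk _].
  by rewrite (key_lt_same xk yk) /= lt_lexiE /= xk yk.
- by apply: sorted_filter extension_word_sorted; apply: key_lt_trans.
move=> a; rewrite !mem_filter mem_shuffle_word mem_extension_word.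
case a0: (nonzero a); rewrite //= ?andbF //.
by case aP: (a \in carrier P); rewrite ?andbF // zeros_before_extension.
Qed.

Lemma assemble_chain_partition :
  {in carrier P, assemble extension_word chain_partition =1 f}.
Proof.
move=> a aP; have [fz _ _] := fP.
have [a0|a0] := boolP (iszero a); first by rewrite assemble_zero ?fz.
rewrite assemble_nonzero // zeros_before_extension //.
by rewrite chain_partition_shift //= -surjective_pairing.
Qed.

End OneLine.

Lemma assemble_surj : exists w pi (g : letter r n -> colored r X),
  [/\ lin_ext P w, colored_shuffle w pi, compatible (chain_poset pi) g
    & {in carrier P, assemble w g =1 f}].
Proof.
have [||pi piE] :=
  @nonzero_one_line shuffle_word (fun a => shift_letter (f a).1 a).
- by rewrite perm_sort.
- by [].
exists extension_word, pi, chain_partition; split.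
- exact: extension_word_lin_ext.
- exact: chain_partition_shuffle.
- exact: chain_partition_compatible.
- exact: assemble_chain_partition.
Qed.

End Surjection.

(** * Transfer to the types of colored partitions *)

Section Reassembly.
Variables (r n : nat) (d : Order.disp_t) (X : tbOrderType d).
Implicit Type P : colored_poset r n.

Definition partition_of P h (hP : compatible P h) : colored_partition X P :=
  exist (fun f => is_true (is_colored_partition f))
    [ffun u : {a : letter r n | a \in carrier P} => h (val u)]
    ((colored_partitionP (ffunE _)).2 hP).

Lemma extend_compatible P (f : colored_partition X P) :
  compatible P (extend (sval f)).
Proof. exact/(colored_partitionP (extendE (sval f)))/(svalP f). Qed.

Lemma extend_partition_of P h (hP : compatible P h) :
  {in carrier P, extend (sval (partition_of hP)) =1 h}.
Proof.
by move=> a aP; rewrite -[a]/(val (exist _ a aP)) -extendE /= ffunE.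
Qed.

Lemma colored_partition_eq P (f g : colored_partition X P) :
  {in carrier P, extend (sval f) =1 extend (sval g)} -> f = g.
Proof.
case: f g => [f hf] [g hg] /= E.
have e : f = g by apply/ffunP => u; rewrite !extendE E // (valP u).
by move: hf hg; rewrite e => hf hg; rewrite (eq_irrelevance hf hg).
Qed.

Variable P : colored_poset r n.
Hypothesis hP : num_nonzero P = n.

Notation triple :=
  {wpi : colored_lin_ext P & colored_partition X (chain_poset (sval wpi).2)}.

Lemma reassemble_compatible (t : triple) :
  compatible P (assemble (sval (tag t)).1 (extend (sval (tagged t)))).
Proof.
have /andP[wP sh] := svalP (tag t).
apply: (assemble_compatible hP wP sh); exact: extend_compatible.
Qed.

Definition reassemble (t : triple) : colored_partition X P :=
  partition_of (reassemble_compatible t).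

Lemma reassemble_inj : injective reassemble.
Proof.
move=> t t' e.
have E : {in carrier P,
    assemble (sval (tag t)).1 (extend (sval (tagged t))) =1
    assemble (sval (tag t')).1 (extend (sval (tagged t')))}.
  move=> a aP; rewrite -(extend_partition_of (reassemble_compatible t)) //.
  rewrite -(extend_partition_of (reassemble_compatible t')) //.
  by rewrite -/(reassemble t) -/(reassemble t') e.
have /andP[wP sh] := svalP (tag t); have /andP[wP' sh'] := svalP (tag t').
have [] := assemble_inj hP wP sh (extend_compatible _)
  wP' sh' (extend_compatible _) E.
case: t t' {e E wP sh wP' sh'} => [[[w pi] h] g] [[[w' pi'] h'] g'] /= ew epi.
(* The type of [g'] depends on the pair and on its proof, so these are identified before [g] and
   [g'] are compared. *)
subst w' pi'; rewrite (eq_irrelevance h' h) in g' *.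
by move=> E; congr existT; apply: colored_partition_eq.
Qed.

Lemma reassemble_surj (f : colored_partition X P) : exists t, reassemble t = f.
Proof.
have [w [pi [g [wP sh gP E]]]] := assemble_surj hP (extend_compatible f).
have h : lin_ext P w && colored_shuffle w pi by rewrite wP sh.
pose wpi : colored_lin_ext P := exist
  (fun wpi => is_true (lin_ext P wpi.1 && colored_shuffle wpi.1 wpi.2))
  (w, pi) h.
exists (existT (fun wpi : colored_lin_ext P =>
  colored_partition X (chain_poset (sval wpi).2)) wpi
  (@partition_of (chain_poset pi) g gP)).
apply: colored_partition_eq => a aP; rewrite extend_partition_of // -E //=.
have [wE uw anc] := lin_ext_word hP wP.
have [a0|a0] := boolP (iszero a); first by rewrite !assemble_zero.
rewrite !assemble_nonzero // extend_partition_of // inE mem_cat.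
apply/orP; left; apply/(mem_one_line anc _ sh); last by exists a; rewrite wE.
by move=> b c; rewrite !wE; apply: carrier_inj.
Qed.

End Reassembly.

Theorem mainTheorem1 (r n : nat) (hr : 0 < r) (hn : 0 < n)
    (d : Order.disp_t) (X : tbOrderType d)
    (hX : exists g : X -> nat, injective g)
    (P : colored_poset r n) (hP : num_nonzero P = n) :
  exists F : colored_partition X P ->
      {wpi : colored_lin_ext P & colored_partition X (chain_poset (sval wpi).2)},
    bijective F.
Proof.
(* The fibres are presented as choice types, so that the inverse of [reassemble] can be picked by
   [xchoose]. *)
pose T (wpi : {wpi : seq (letter r n) * colored_perm r n |
    lin_ext P wpi.1 && colored_shuffle wpi.1 wpi.2}) : choiceType :=
  {f : {ffun {a : letter r n | a \in carrier (chain_poset (sval wpi).2)} ->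
    colored r X} | is_colored_partition f}.
apply: (@inj_surj_inverse_bij {wpi : _ & T wpi}
  {f : {ffun {a : letter r n | a \in carrier P} -> colored r X} |
     is_colored_partition f} (reassemble hP)).
  exact: reassemble_inj.
by move=> f; have [t <-] := reassemble_surj hP f; exists t.
Qed.
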